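(* For any $m\in\mathbb{N}$ and any integer $p\ge1$, $$\sum_{1\le N_1<\cdots<N_m}\frac{1}{N_m^{2p}\cdots N_1^{2p}}=(-1)^m\sum_{\substack{(y_1,\ldots,y_m)\\ \sum i y_i=m}}\prod_{i=1}^{m}\frac{(-1)^{y_i}}{y_i!\,i^{y_i}}\big(\zeta(2ip)\big)^{y_i}=(-1)^{(p+1)m}(2\pi)^{2pm}\sum_{\substack{(y_1,\ldots,y_m)\\ \sum i y_i=m}}\prod_{i=1}^{m}\frac{1}{y_i!}\left(\frac{B_{2ip}}{(2i)\,(2ip)!}\right)^{y_i},$$ where the sums over $(y_1,\ldots,y_m)$ run over all partitions of $m$.
   Context: $\mathbb{N}=\{0,1,2,\ldots\}$. $\zeta$ is the Riemann zeta function and $B_j$ are the Bernoulli numbers, $\frac{t}{e^t-1}=\sum_{j\ge0}B_j\frac{t^j}{j!}$. A partition of $m$ is represented by the tuple $(y_1,\ldots,y_m)$ of non-negative integers with $\sum_{i=1}^m i\,y_i=m$. For $m=0$ there is exactly one partition, the empty one. Empty products equal $1$. The series on the left ranges over all strictly increasing $m$-tuples of positive integers and equals $1$ when $m=0$. *)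

(* Defs.v *)
From HB Require Import structures.
From mathcomp Require Import all_boot all_order all_algebra.
From mathcomp Require Import all_classical all_reals all_analysis.

Set Implicit Arguments.
Unset Strict Implicit.
Unset Printing Implicit Defensive.

Import Order.TTheory GRing.Theory Num.Theory.
Import numFieldNormedType.Exports.

Local Open Scope classical_set_scope.
Local Open Scope ring_scope.

(* Dirichlet series of the Riemann zeta function; it is zeta only for s > 1. *)
Definition zeta (R : realType) (s : R) : R :=
  limn (series (fun n : nat => n.+1%:R `^ (- s))).

(* The identity t / (e^t - 1) = \sum_(j >= 0) B_j t^j / j! for real t in a
   punctured neighbourhood of 0 (at t = 0 the quotient is only a removable
   singularity). *)
Definition bernoulli_egf (R : realType) (B : nat -> R) : Prop :=
  \forall t \near (0 : R)^',
    series (fun j : nat => B j * t ^+ j / j`!%:R) @ \oo --> t / (expR t - 1).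

(* Exactly one sequence satisfies [bernoulli_egf] (the quotient extends
   analytically to 0, and a power series is determined by its sum near 0), so
   the default value 0 of [xget] is never used. *)
Definition bernoulli_number (R : realType) : nat -> R :=
  xget (fun=> 0) [set B : nat -> R | bernoulli_egf B].

(* A partition of m as its tuple of multiplicities: the index i : 'I_m stands
   for the part i.+1, and y i is the number of parts equal to i.+1. Since
   i.+1 * y i <= m, bounding the multiplicities by m loses no partition. *)
Definition is_partition (m : nat) (y : {ffun 'I_m -> 'I_m.+1}) : bool :=
  (\sum_(i < m) i.+1 * y i == m)%N.

Definition increasing_tuples (m : nat) : set (m.-tuple nat) :=
  [set N : m.-tuple nat | sorted ltn N /\ forall i : 'I_m, (0 < tnth N i)%N].
Arguments increasing_tuples : clear implicits.

(* Main.v *)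
Require Import Defs.
From HB Require Import structures.
From mathcomp Require Import all_boot all_order all_algebra.
From mathcomp Require Import all_classical all_reals all_analysis.
From mathcomp Require Import ring lra zify.

(** Truncated at N_m <= M, the series is the elementary symmetric function
    e_m of the numbers x_k = k^(-2p), k <= M.  The polynomial
    G = \prod_k (1 - x_k X) has coefficients (-1)^m e_m, and its logarithmic
    derivative is - \sum_j p_(j+1) X^j, where p_j is the j-th power sum of the
    x_k.  The truncated exponential
    \prod_j exp (- p_j X^j / j) has the same logarithmic derivative up to a high
    power of X.  A polynomial with constant coefficient 1 is determined by its
    logarithmic derivative, degree by degree, so the coefficients of X^m agree;
    expanding the product of exponentials gives the sum over the partitions of m
    ([partition_sum_power_sums]).  As M grows, p_j tends to zeta(2jp) and the
    first equality follows ([esum_multiple_zeta]).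

    The second equality is a termwise rewriting by Euler's formula for zeta(2k)
    ([euler_zeta_even]), and that formula comes from the same recursion.  For
    n = 2N+1, sin(n t) / (cos(t)^n tan(t)) is a polynomial in tan(t)^2 whose
    roots are the squared tangents of pi j / n, 1 <= j <= N.  Hence, up to the
    factor n, it is \prod_j (1 - cot(pi j / n)^2 X), and Newton's identities
    relate the power sums of the squared cotangents to the odd binomial
    coefficients 'C(n, 2k+1).  Rescaling by powers of n and letting N grow turns
    the power sums into zeta(2k) / pi^(2k), because cot(t)^2 lies between
    t^(-2) - 1 and t^(-2), and the binomial coefficients into 1/(2k+1)!.
    The limit ([euler_recursion]) is a recursion for
    zeta(2k) which says precisely that a certain power series C, with
    coefficients +-2 zeta(2k) / pi^(2k), satisfies C(u) sinh(u) = u cosh(u)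
    ([coth_coef_convolution], [cvg_coth_series]).  Since
    t / (e^t - 1) = u coth(u) - u for u = t / 2, the coefficients of C give an
    explicit solution of the equation that defines the Bernoulli numbers, and it
    is the only one because a power series is determined by its sum near 0
    ([power_series_eq0]). *)

Set Implicit Arguments.
Unset Strict Implicit.
Unset Printing Implicit Defensive.

Import Order.TTheory GRing.Theory Num.Theory.
Import numFieldNormedType.Exports.

Local Open Scope classical_set_scope.
Local Open Scope ring_scope.

(** * Logarithmic derivatives, Newton's identities and partition sums *)

Section LogarithmicDerivative.
Variable F : fieldType.
Implicit Types P Q S T : {poly F}.

(** S is the logarithmic derivative of P modulo X^m, stated without division so
    that it makes sense for every polynomial P. *)
Definition log_deriv_mod m P S := 'X^m %| P^`() - P * S.

Lemma log_deriv_mod1 m : log_deriv_mod m 1 0.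
Proof. by rewrite /log_deriv_mod derivC mulr0 subr0 dvdp0. Qed.

Lemma log_deriv_modM m P Q S T :
  log_deriv_mod m P S -> log_deriv_mod m Q T -> log_deriv_mod m (P * Q) (S + T).
Proof.
move=> PS QT; rewrite /log_deriv_mod derivM.
have -> : P^`() * Q + P * Q^`() - P * Q * (S + T)
        = (P^`() - P * S) * Q + (Q^`() - Q * T) * P by ring.
by apply: dvdp_add; apply: dvdp_mulr.
Qed.

Lemma log_deriv_mod_prod m (I : Type) (r : seq I) (P S : I -> {poly F}) :
  (forall i, log_deriv_mod m (P i) (S i)) ->
  log_deriv_mod m (\prod_(i <- r) P i) (\sum_(i <- r) S i).
Proof.
move=> PS; elim/big_rec2 : _ => [|i T Q _ QT]; first exact: log_deriv_mod1.
exact: log_deriv_modM.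
Qed.

(** Comparing the coefficients of X^n in P' = P S; together with the constant
    coefficient, in characteristic 0, this determines P up to degree m. *)
Lemma log_deriv_mod_rec m P S n : log_deriv_mod m P S -> (n < m)%N ->
  n.+1%:R * P`_n.+1 = \sum_(i < n.+1) P`_i * S`_(n - i).
Proof.
move=> /dvdpP[Q PSQ] nm; have /(congr1 (fun p : {poly F} => p`_n)) := PSQ.
rewrite coefB coefMXn nm coef_deriv coefM => /eqP.
by rewrite subr_eq0 => /eqP <-; rewrite mulr_natl.
Qed.

(** The logarithmic derivative of 1 - xX is - x / (1 - xX), a geometric
    series. *)
Lemma log_deriv_mod_1subX m (x : F) :
  log_deriv_mod m (1 - x *: 'X) (- \poly_(i < m) x ^+ i.+1).
Proof.
rewrite /log_deriv_mod derivB derivZ derivX derivC.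
suff -> : 0 - x *: 1 - (1 - x *: 'X) * - \poly_(i < m) x ^+ i.+1
        = (- x ^+ m.+1)%:P * 'X^m :> {poly F} by apply: dvdp_mulIr.
elim: m => [|m IHm].
  rewrite (_ : \poly_(i < 0) _ = 0); last first.
    by apply/polyP => i; rewrite coef_poly coef0.
  by rewrite expr0 expr1 mulr1 oppr0 mulr0 subr0 sub0r -mul_polyC mulr1 polyCN.
have -> : \poly_(i < m.+1) x ^+ i.+1
        = \poly_(i < m) x ^+ i.+1 + (x ^+ m.+1)%:P * 'X^m.
  by rewrite !poly_def big_ord_recr /= mul_polyC.
rewrite -!mul_polyC in IHm *.
rewrite !(exprS _ m.+1) !polyCN !polyCM in IHm *.
set A := \poly_(i < m) _ in IHm *; set a := (x ^+ m.+1)%:P in IHm *.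
have -> : 0 - x%:P * 1 - (1 - x%:P * 'X) * - (A + a * 'X^m)
  = (0 - x%:P * 1 - (1 - x%:P * 'X) * - A) + (1 - x%:P * 'X) * a * 'X^m by ring.
by rewrite IHm exprS; ring.
Qed.

Lemma newton_identity (I : Type) (r : seq I) (x : I -> F) n :
  let P := \prod_(i <- r) (1 - x i *: 'X) in
  n.+1%:R * P`_n.+1 =
  - \sum_(k < n.+1) P`_k * \sum_(i <- r) x i ^+ (n - k).+1.
Proof.
move=> P; rewrite /P (log_deriv_mod_rec (log_deriv_mod_prod r
  (fun i => log_deriv_mod_1subX n.+1 (x i))) (ltnSn n)).
rewrite -sumrN; apply: eq_bigr => k _; rewrite -mulrN; congr (_ * _).
rewrite coef_sum -sumrN; apply: eq_bigr => i _.
by rewrite coefN coef_poly ltnS leq_subr.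
Qed.

Lemma log_deriv_rec_unique m (a b s : nat -> F) :
  (forall n, (n < m)%N -> n.+1%:R != 0 :> F) -> a 0%N = b 0%N ->
  (forall n, (n < m)%N -> n.+1%:R * a n.+1 = \sum_(i < n.+1) a i * s (n - i)%N) ->
  (forall n, (n < m)%N -> n.+1%:R * b n.+1 = \sum_(i < n.+1) b i * s (n - i)%N) ->
  forall n, (n <= m)%N -> a n = b n.
Proof.
move=> n_neq0 ab0 ra rb; elim/ltn_ind => -[//|n] IHn nm.
apply: (mulfI (n_neq0 _ nm)); rewrite ra// rb//; apply: eq_bigr => i _.
by rewrite IHn // (leq_trans _ nm)// ltnW// ltnS ltn_ord.
Qed.

End LogarithmicDerivative.

Section PartitionSum.
Variable F : numFieldType.

Definition partition_sum m (c : nat -> F) : F :=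
  \sum_(y : {ffun 'I_m -> 'I_m.+1} | is_partition y)
    \prod_(i < m) (c i ^+ y i / (y i)`!%:R).

(** The exponential of c X^j truncated after m + 1 terms, so that it is a
    polynomial. *)
Definition exp_poly m j (c : F) : {poly F} :=
  \sum_(k < m.+1) (c ^+ k / k`!%:R) *: 'X^(j * k).

Lemma deriv_exp_poly m j c : (exp_poly m.+1 j c)^`() =
  (c *+ j) *: 'X^(j.-1) * exp_poly m j c.
Proof.
rewrite /exp_poly raddf_sum big_ord_recl /= muln0 derivZ derivC scaler0 add0r.
rewrite mulr_sumr; apply: eq_bigr => k _; rewrite derivZ derivXn /= /bump /=.
rewrite add1n -scalerAl -scalerAr scalerA -exprD.
case: j => [|j]; first by rewrite !mul0n !mulr0n scaler0 mul0r scale0r.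
rewrite -scalerMnr scalerMnl; congr (_ *: 'X^_); last by rewrite mulnS addSn.
rewrite -mulr_natr -(mulr_natr c) factS exprS !natrM.
have k0 : k.+1%:R != 0 :> F by rewrite pnatr_eq0.
have f0 : k`!%:R != 0 :> F by rewrite pnatr_eq0 -lt0n fact_gt0.
by move: k0 f0; move: k.+1%:R k`!%:R => K f k0 f0; field; rewrite f0 k0.
Qed.

(** The derivative of the truncated exponential has the expected shape except
    that the last term, a multiple of X^m because j > 0, is missing. *)
Lemma log_deriv_mod_exp_poly m j c : (0 < j)%N ->
  log_deriv_mod m (exp_poly m j c) ((c *+ j) *: 'X^(j.-1)).
Proof.
case: m => [|m] j0; first by rewrite /log_deriv_mod expr0 dvd1p.
rewrite /log_deriv_mod deriv_exp_poly [X in _ - X]mulrC -mulrBr.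
have -> : exp_poly m j c - exp_poly m.+1 j c
        = - (c ^+ m.+1 / m.+1`!%:R) *: 'X^(j * m.+1).
  rewrite {2}/exp_poly big_ord_recr /= -/(exp_poly _ _ _) scaleNr.
  by rewrite opprD addrA subrr sub0r.
rewrite -(subnK (_ : m.+1 <= j * m.+1)%N) ?leq_pmull// exprD.
by rewrite -[- _ *: _]mul_polyC; do 3!apply: dvdp_mull; exact: dvdpp.
Qed.

Definition exp_poly_prod m (c : nat -> F) : {poly F} :=
  \prod_(i < m) exp_poly m i.+1 (c i).

(** Choosing one term c_i^(y_i) / y_i! X^((i+1) y_i) in each factor, the degree
    is m exactly when y is a partition of m. *)
Lemma coef_exp_poly_prod m c : (exp_poly_prod m c)`_m = partition_sum m c.
Proof.
rewrite /exp_poly_prod /exp_poly bigA_distr_bigA coef_sum /= /partition_sum.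
rewrite [RHS]big_mkcond; apply: eq_bigr => y _.
rewrite scaler_prod -expr_sum coefZ coefXn /is_partition eq_sym.
by case: ifP; rewrite ?mulr1 ?mulr0.
Qed.

(** Both sides are the coefficient of X^m of a polynomial with constant
    coefficient 1, and the two polynomials have the same logarithmic derivative
    modulo X^m. *)
Lemma partition_sum_power_sums (I : Type) (r : seq I) (x : I -> F) m :
  (\prod_(i <- r) (1 - x i *: 'X))`_m =
  partition_sum m (fun j => - (\sum_(i <- r) x i ^+ j.+1) / j.+1%:R).
Proof.
set c := fun j : nat => _; pose P := \prod_(i <- r) (1 - x i *: 'X).
pose s j := - \sum_(i <- r) x i ^+ j.+1.
rewrite -coef_exp_poly_prod -/P.
apply: (@log_deriv_rec_unique _ m (fun n => P`_n)
  (fun n => (exp_poly_prod m c)`_n) s) => [n _||n nm|n nm|]; last exact: leqnn.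
- by rewrite pnatr_eq0.
- rewrite -!horner_coef0 /exp_poly_prod /P !horner_prod !big1// => i _.
    rewrite /exp_poly horner_sum big_ord_recl/= muln0 expr0 fact0 divr1 scale1r.
    rewrite big1 ?hornerE// => k _.
    by rewrite !hornerE expr0n/= mulr0.
  by rewrite !hornerE ?mulr0 ?subr0 ?oppr0 ?addr0.
- by rewrite newton_identity -sumrN; apply: eq_bigr => k _; rewrite mulrN.
- rewrite (log_deriv_mod_rec (log_deriv_mod_prod _
    (fun i : 'I_m => log_deriv_mod_exp_poly m (c i) (ltn0Sn i))) nm).
  apply: eq_bigr => k _; congr (_ * _); rewrite coef_sum.
  have km : (n - k < m)%N by rewrite (leq_ltn_trans (leq_subr _ _)).
  rewrite (bigD1 (Ordinal km))//= coefZ coefXn eqxx mulr1 big1 ?addr0.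
    by rewrite -mulr_natr /c divfK// pnatr_eq0.
  move=> i; rewrite -val_eqE/= => /negPf ik.
  by rewrite coefZ coefXn eq_sym ik mulr0.
Qed.

End PartitionSum.

(** * Strictly increasing tuples and elementary symmetric functions *)

Section IncreasingTuples.

Definition increasing_tuples_le m M : set (m.-tuple nat) :=
  increasing_tuples m `&` [set N | forall i, (tnth N i <= M)%N].
Arguments increasing_tuples_le : clear implicits.

Definition tuple_of_set m M (A : {set 'I_M}) : m.-tuple nat :=
  [tuple nth 0%N [seq k.+1 | k : 'I_M in A] i | i < m].

Lemma tuple_of_setE m M (A : {set 'I_M}) : #|A| = m ->
  tuple_of_set m A = [seq k.+1 | k : 'I_M in A] :> seq nat.
Proof.
move=> Am; apply: (@eq_from_nth _ 0%N) => [|i im].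
  by rewrite size_tuple size_map -cardE.
have {}im : (i < m)%N by rewrite size_tuple in im.
by rewrite -[LHS](tnth_nth 0%N (tuple_of_set m A) (Ordinal im)) tnth_mktuple.
Qed.

Lemma mem_tuple_of_set m M (A : {set 'I_M}) (k : 'I_M) : #|A| = m ->
  (k.+1 \in tuple_of_set m A) = (k \in A).
Proof.
move=> Am; have -> : (k.+1 \in tuple_of_set m A)
    = (k.+1 \in [seq k.+1 | k : 'I_M in A]).
  by rewrite -(tuple_of_setE Am).
apply/mapP/idP => [[j]|kA]; last by exists k; rewrite ?mem_enum.
by rewrite mem_enum => jA [/val_inj ->].
Qed.

Lemma sorted_succ_enum M (A : {set 'I_M}) :
  sorted ltn [seq k.+1 | k : 'I_M in A].
Proof.
rewrite /image_mem (map_comp S val) sorted_map.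
apply: (@sub_sorted _ ltn) => //.
rewrite -[enum _](eq_filter (mem_enum _)).
rewrite -(eq_filter (mem_map val_inj _)) -filter_map.
by rewrite (sorted_filter ltn_trans) // unlock val_ord_enum iota_ltn_sorted.
Qed.

(** An increasing tuple is determined by its set of entries; the shift k |-> k+1
    accounts for ordinals starting at 0. *)
Lemma tuple_of_set_bij m M :
  set_bij [set A : {set 'I_M} | #|A| = m] (increasing_tuples_le m M)
    (@tuple_of_set m M).
Proof.
split=> [A /= Am|A B /[!inE]/= Am Bm AB|N /= [[sN N0] NM]].
- have tA (i : 'I_m) : exists k : 'I_M, tnth (tuple_of_set m A) i = k.+1.
    have := mem_tnth i (tuple_of_set m A).
    rewrite [_ \in _](_ : _ = (tnth (tuple_of_set m A) i
      \in [seq k.+1 | k : 'I_M in A])) -?(tuple_of_setE Am)// tuple_of_setE//.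
    by case/mapP => k _ ->; exists k.
  split; [split|] => [|i|i] /=.
  + by rewrite tuple_of_setE// sorted_succ_enum.
  + by have [k ->] := tA i.
  + by have [k ->] := tA i; apply: ltn_ord.
- by apply/setP => k; rewrite -(mem_tuple_of_set _ Am) -(mem_tuple_of_set _ Bm) AB.
- pose A := finset (fun k : 'I_M => k.+1 \in N).
  have eN : [seq k.+1 | k : 'I_M in A] = N.
    apply: (irr_sorted_eq ltn_trans ltnn) => [||y]; rewrite ?sorted_succ_enum//.
    apply/mapP/idP => [[k]|yN]; first by rewrite mem_enum inE => kN ->.
    have /tnthP[i yi] := yN; have y0 := N0 i; have yM := NM i.
    rewrite -yi in y0 yM; case: y => // y in yN yi y0 yM *.
    by exists (Ordinal yM); rewrite // mem_enum inE.
  have Am : #|A| = m by have /(congr1 size) := eN; rewrite size_map -cardE size_tuple.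
  by exists A => //; apply: val_inj; rewrite -[RHS]eN -(tuple_of_setE Am).
Qed.

Lemma sum_increasing_tuples_le (R : realType) (g : nat -> R) m M :
  (forall k, 0 <= g k) ->
  (\esum_(N in increasing_tuples_le m M) (\prod_(i < m) g (tnth N i))%R%:E
  = (\sum_(A : {set 'I_M} | #|A| == m) \prod_(k in A) g k.+1)%R%:E)%E.
Proof.
move=> g0; rewrite (reindex_esum _ _ _ _ (tuple_of_set_bij m M)).
rewrite esum_fset; [|exact: finite_finset|by move=> A _; rewrite lee_fin prodr_ge0].
rewrite fsumEFin; [congr EFin|exact: finite_finset].
rewrite (fsbigE (enum (fun A : {set 'I_M} => #|A| == m))) ?enum_uniq//=.
- rewrite big_enum_cond/= [RHS]big_mkcond [LHS]big_mkcond; apply: eq_bigr => A _.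
  rewrite unfold_in; case: eqP => [Am|//]; rewrite mem_set//
    -(big_tuple _ _ (tuple_of_set m A) xpredT g).
  by rewrite tuple_of_setE// big_map big_enum.
- by move=> A /=; rewrite mem_enum => /eqP.
- by move=> A /= Am; rewrite mem_enum unfold_in Am eqxx.
Qed.

(** The terms are nonnegative and every finite set of increasing tuples has
    bounded entries, so the unordered sum is the supremum of the sums over the
    tuples with entries at most M. *)
Lemma esum_increasing_tuples (R : realType) (g : nat -> R) m (l : R) :
  (forall k, 0 <= g k) ->
  (\sum_(A : {set 'I_M} | #|A| == m) \prod_(k in A) g k.+1) @[M --> \oo] --> l ->
  (\esum_(N in increasing_tuples m) (\prod_(i < m) g (tnth N i))%R%:E = l%:E)%E.
Proof.
move=> g0; set E := fun M => _ => El.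
have EE M : (E M)%:E = (\esum_(N in increasing_tuples_le m M)
    (\prod_(i < m) g (tnth N i))%R%:E)%E.
  by rewrite sum_increasing_tuples_le.
have w0 (N : m.-tuple nat) : (0 <= (\prod_(i < m) g (tnth N i))%:E)%E.
  by rewrite lee_fin prodr_ge0.
have sub_le (A B : set (m.-tuple nat)) : A `<=` B ->
    (\esum_(N in A) (\prod_(i < m) g (tnth N i))%R%:E <=
     \esum_(N in B) (\prod_(i < m) g (tnth N i))%R%:E)%E.
  move=> AB; apply: ereal_sup_le => _ [X [fX XA] <-].
  by exists X => //; split=> // x /XA /AB.
have ndE : nondecreasing_seq E.
  move=> M M' MM'; rewrite -lee_fin !EE; apply: sub_le => N [iN NM].
  by split=> // i /=; rewrite (leq_trans (NM i)).
apply/eqP; rewrite eq_le; apply/andP; split.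
- apply: ge_ereal_sup => _ [X [fX XN] <-].
  have [M XM] : exists M, X `<=` increasing_tuples_le m M.
    have /finite_seqP[s Xs] := fX.
    exists (\max_(N <- s) \max_(i < m) tnth N i)%N => N NX.
    split=> [|i]; first exact: XN.
    apply: leq_trans (leq_bigmax (F := tnth N) i) _.
    by apply: leq_bigmax_seq => //; rewrite Xs in NX.
  apply: (@le_trans _ _ (E M)%:E).
    by rewrite EE; apply: esum_ge; exists X.
  rewrite lee_fin -(cvg_lim _ El)//; apply: nondecreasing_cvgn_le => //.
  by apply/cvg_ex; exists l.
- have := w0; set e := esum _ _ => _.
  have eE M : ((E M)%:E <= e)%E by rewrite EE; apply: sub_le => N [].
  case: e eE => [r||] eE; rewrite ?leey//; last by have := eE 0%N.
  rewrite lee_fin -(cvg_lim _ El)//; apply: limr_le.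
    by apply/cvg_ex; exists l.
  by apply: nearW => M; rewrite -lee_fin.
Qed.

End IncreasingTuples.

Lemma coef_prod_1subX (F : comNzRingType) (I : finType) (x : I -> F) m :
  (\prod_i (1 - x i *: 'X))`_m =
  (-1) ^+ m * \sum_(A : {set I} | #|A| == m) \prod_(i in A) x i.
Proof.
under eq_bigr do rewrite addrC -scaleNr.
rewrite bigA_distr coef_sum/= mulr_sumr [RHS]big_mkcond/=; apply: eq_bigr => A _.
rewrite -big_mkcond/= scaler_prod prodr_const coefZ coefXn eq_sym.
case: eqP => [<-|_]; last by rewrite mulr0.
by rewrite mulr1 prodrN.
Qed.

(** * Limits of real sequences *)

(** The operations on limits are restated for sequences written as functions of
    the index, so that they compose as terms and their conclusions match by
    unification. *)
Lemma cvg_eq_fun (R : realType) (f g : nat -> R) (l : R) :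
  f =1 g -> f @ \oo --> l -> g @ \oo --> l.
Proof. by move=> /funext ->. Qed.

Lemma cvg_seqM (R : realType) (u v : nat -> R) (a b : R) :
  u @ \oo --> a -> v @ \oo --> b -> (fun n => u n * v n) @ \oo --> a * b.
Proof. exact: cvgM. Qed.

Lemma cvg_seqD (R : realType) (u v : nat -> R) (a b : R) :
  u @ \oo --> a -> v @ \oo --> b -> (fun n => u n + v n) @ \oo --> a + b.
Proof. exact: cvgD. Qed.

Lemma cvg_seqB (R : realType) (u v : nat -> R) (a b : R) :
  u @ \oo --> a -> v @ \oo --> b -> (fun n => u n - v n) @ \oo --> a - b.
Proof. exact: cvgB. Qed.

Lemma cvg_seq_sum (R : realType) (I : Type) (r : seq I) (P : pred I)
    (u : I -> nat -> R) (a : I -> R) :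
  (forall i, P i -> u i @ \oo --> a i) ->
  (fun n => \sum_(i <- r | P i) u i n) @ \oo --> \sum_(i <- r | P i) a i.
Proof. by move=> ua; apply: cvg_big => //; exact: add_continuous. Qed.

Lemma cvg_seq_prod (R : realType) (I : Type) (r : seq I) (P : pred I)
    (u : I -> nat -> R) (a : I -> R) :
  (forall i, P i -> u i @ \oo --> a i) ->
  (fun n => \prod_(i <- r | P i) u i n) @ \oo --> \prod_(i <- r | P i) a i.
Proof. by move=> ua; apply: cvg_big => //; exact: mul_continuous. Qed.

Lemma cvg_seq_comp (R : realType) (u : nat -> R) (h : nat -> nat) (l : R) :
  (forall N, exists M, forall n, (M <= n)%N -> (N <= h n)%N) ->
  u @ \oo --> l -> (u \o h) @ \oo --> l.
Proof.
move=> hoo ul; apply: cvg_comp ul => P [N _ NP].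
by have [M hM] := hoo N; exists M => // n /= /hM /NP.
Qed.

(** * Multiple angles and cotangents *)

Section MultipleAngle.
Variable R : realType.

(** With X standing for tan(t)^2, these are the imaginary part, divided by
    tan(t), and the real part of (1 + i tan(t))^n. *)
Definition sin_tan_poly n : {poly R} :=
  \poly_(i < n.+1./2) ((-1) ^+ i * 'C(n, i.*2.+1)%:R).

Definition cos_tan_poly n : {poly R} :=
  \poly_(i < n.+1) ((-1) ^+ i * 'C(n, i.*2)%:R).

Lemma coef_sin_tan_poly n i :
  (sin_tan_poly n)`_i = (-1) ^+ i * 'C(n, i.*2.+1)%:R.
Proof.
rewrite coef_poly; case: ltnP => // ni.
by rewrite leq_half_double in ni; rewrite bin_small ?mulr0.
Qed.

Lemma coef_cos_tan_poly n i : (cos_tan_poly n)`_i = (-1) ^+ i * 'C(n, i.*2)%:R.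
Proof.
rewrite coef_poly; case: ltnP => // ni; rewrite bin_small ?mulr0//.
by rewrite (leq_trans ni)// -addnn leq_addr.
Qed.

(** Pascal's rule; together with [cos_tan_polyS] it mirrors the addition
    formulas for the angles n t and t. *)
Lemma sin_tan_polyS n :
  sin_tan_poly n.+1 = sin_tan_poly n + cos_tan_poly n.
Proof.
apply/polyP => i; rewrite coefD !coef_sin_tan_poly coef_cos_tan_poly.
by rewrite binS natrD mulrDr.
Qed.

Lemma cos_tan_polyS n :
  cos_tan_poly n.+1 = cos_tan_poly n - 'X * sin_tan_poly n.
Proof.
apply/polyP => -[|i]; rewrite coefB coefXM !coef_cos_tan_poly /=.
  by rewrite !bin0 subr0.
by rewrite coef_sin_tan_poly doubleS binS natrD exprS; ring.
Qed.

(** De Moivre's formula, by induction on n with the addition formulas. *)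
Lemma sin_cos_natmul n (t : R) : cos t != 0 ->
  sin (n%:R * t) = cos t ^+ n * tan t * (sin_tan_poly n).[tan t ^+ 2] /\
  cos (n%:R * t) = cos t ^+ n * (cos_tan_poly n).[tan t ^+ 2].
Proof.
move=> ct; elim: n => [|n [IHs IHc]].
  rewrite mul0r sin0 cos0 /sin_tan_poly /cos_tan_poly /= !poly_def.
  by rewrite big_ord0 big_ord1 !hornerE.
have st : sin t = cos t * tan t by rewrite /tan mulrC divfK.
move: (tan t) st IHs IHc => T st IHs IHc.
rewrite -natr1 mulrDl mul1r sinD cosD IHs IHc sin_tan_polyS cos_tan_polyS.
by rewrite st !hornerD hornerN hornerM hornerX [cos t ^+ n.+1]exprS; split; ring.
Qed.

Lemma sin_natmul_pi n : sin (n%:R * pi) = 0 :> R.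
Proof.
elim: n => [|n IHn]; first by rewrite mul0r sin0.
by rewrite -natr1 mulrDl mul1r sinDpi IHn oppr0.
Qed.

(** Both bounds come from the mean value theorem: sin(t) = t cos(x) for some x
    between 0 and t, and cos decreases there. *)
Lemma sin_le_id_tan (t : R) : 0 < t < pi / 2 -> t * cos t <= sin t <= t.
Proof.
move=> /andP[t0 tpi]; have pi0 := pi_gt0 R.
have [x xt] : exists2 x, x \in `]0, t[ & sin t - sin 0 = cos x * (t - 0).
  by apply: MVT => //; apply: continuous_subspaceT; exact: continuous_sin.
rewrite sin0 !subr0 => ->; move: xt; rewrite in_itv/= => /andP[x0 xt].
rewrite mulrC !ler_pM2r ?gtr_pMl//; apply/andP; split; last first.
  by rewrite ler_piMl ?cos_le1// ltW.
by apply/ltW; rewrite ltr_cos ?in_itv/=; lra.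
Qed.

Definition cot_node n j : R := j.+1%:R * pi / n%:R.

Lemma cot_node_itv N (j : 'I_N) : 0 < cot_node N.*2.+1 j < pi / 2.
Proof.
have pi0 := pi_gt0 R; have n0 : 0 < N.*2.+1%:R :> R by rewrite ltr0n.
apply/andP; split; first by rewrite /cot_node divr_gt0 ?mulr_gt0.
rewrite ltr_pdivrMr// mulrC mulrAC -mulrA ltr_pM2l// ltr_pdivlMr//.
by rewrite -natrM ltr_nat muln2 ltnS leq_double.
Qed.

Lemma cot_node_tan_gt0 N (j : 'I_N) : 0 < tan (cot_node N.*2.+1 j).
Proof.
have /andP[j0 jpi] := cot_node_itv j; have pi0 := pi_gt0 R.
rewrite /tan divr_gt0 ?sin_gt0_pihalf ?cos_gt0_pihalf ?j0//=.
by apply/andP; split=> //; lra.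
Qed.

(** The squared tangents at the N nodes are distinct roots of a polynomial of
    degree N with constant coefficient 2N+1. *)
Lemma sin_tan_poly_prod N :
  sin_tan_poly N.*2.+1 =
  N.*2.+1%:R *: \prod_(j < N) (1 - (tan (cot_node N.*2.+1 j) ^- 2) *: 'X).
Proof.
have pi0 := pi_gt0 R; set n := N.*2.+1; set P := sin_tan_poly n.
have n0 : n%:R != 0 :> R by rewrite pnatr_eq0.
pose r (j : 'I_N) : R := tan (cot_node n j) ^+ 2.
have r0 j : r j != 0 by rewrite expf_neq0// gt_eqF// cot_node_tan_gt0.
have sP : size P = N.+1.
  rewrite /P /sin_tan_poly size_poly_eq /n -doubleS half_double//=.
  by rewrite binn mulr1 signr_eq0.
have rootP : all (root P) [seq r j | j : 'I_N].
  apply/allP => _ /mapP[j _ ->]; rewrite /root.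
  have /andP[j0 jpi] := cot_node_itv j.
  have cj : cos (cot_node n j) != 0.
    by rewrite gt_eqF// cos_gt0_pihalf//; apply/andP; split=> //; lra.
  have [+ _] := sin_cos_natmul n cj.
  have -> : n%:R * cot_node n j = j.+1%:R * pi by rewrite /cot_node mulrC divfK.
  rewrite sin_natmul_pi => /esym/eqP.
  have tj : tan (cot_node n j) != 0 by rewrite gt_eqF// cot_node_tan_gt0.
  by rewrite mulf_eq0 (negPf (mulf_neq0 (expf_neq0 _ cj) tj)).
have uniqP : uniq_roots [seq r j | j : 'I_N].
  rewrite uniq_rootsE map_inj_uniq ?enum_uniq// => i j.
  rewrite /r => /eqP; rewrite eqrXn2 ?ltW ?cot_node_tan_gt0// => /eqP.
  have /andP[i0 ipi] := cot_node_itv i; have /andP[j0 jpi] := cot_node_itv j.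
  move=> /tan_inj; rewrite !in_itv/= => /(_ _ _)Eij.
  have {Eij} : cot_node n i = cot_node n j by apply: Eij; apply/andP; split=> //; lra.
  move=> /(congr1 (fun x => x * n%:R)); rewrite !divfK//.
  move=> /(mulIf (lt0r_neq0 pi0))/eqP.
  by rewrite eqr_nat eqSS => /eqP/val_inj.
have := all_roots_prod_XsubC _ rootP uniqP.
rewrite size_map -cardE card_ord => /(_ sP) PE.
have {PE} [c PE] : exists c, P = c *: \prod_(j < N) (1 - (r j)^-1 *: 'X).
  exists (lead_coef P * \prod_(j < N) - r j).
  rewrite {1}PE big_map big_enum/= -scalerA -scaler_prod; congr (_ *: _).
  apply: eq_bigr => j _; rewrite scalerBr scalerA mulNr divff//.
  by rewrite scaleN1r opprK -mul_polyC mulr1 polyCN addrC.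
have : P`_0 = n%:R by rewrite coef_sin_tan_poly bin1 mul1r.
rewrite {1}PE coefZ -horner_coef0 horner_prod big1 ?mulr1 => [cn|j _].
  by rewrite PE cn.
by rewrite !hornerE ?mulr0 ?subr0.
Qed.

End MultipleAngle.

(** * Power sums of cotangents and the values of zeta *)

Section ZetaNat.
Variable R : realType.

Lemma zeta_nat n : zeta n%:R = limn (series (fun i => i.+1%:R ^- n : R)) :> R.
Proof.
by congr (limn (series _)); apply/funext => i; rewrite powR_invn.
Qed.

(** Telescoping: 1 / (M+2)^2 <= 1 / (M+1) - 1 / (M+2). *)
Lemma sum_inv_nat_pow_le2 n N : (2 <= n)%N ->
  series (fun i => i.+1%:R ^- n : R) N <= 2 :> R.
Proof.
move=> n2; suff H M : series (fun i => i.+1%:R ^- n : R) M.+1 <= 2 - M.+1%:R^-1 :> R.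
  case: N => [|N]; first by rewrite /series/= big_geq.
  by rewrite (le_trans (H N))// lerBlDr lerDl invr_ge0.
elim: M => [|M IHM].
  by rewrite /series/= big_nat1 expr1n invr1; lra.
rewrite seriesSr; apply: le_trans (lerD IHM (_ : _ <= M.+1%:R^-1 - M.+2%:R^-1)) _.
  apply: (@le_trans _ _ (M.+2%:R ^- 2)).
    by rewrite lef_pV2 ?posrE ?exprn_gt0// ler_eXn2l// ltr1n.
  have M1 : 0 < M.+1%:R :> R by rewrite ltr0n.
  rewrite -[M.+2%:R]natr1; move: (M.+1%:R) M1 => x x0.
  have -> : x^-1 - (x + 1)^-1 = (x * (x + 1))^-1 by field; lra.
  by rewrite lef_pV2 ?posrE; nra.
by rewrite addrA subrK.
Qed.

Lemma cvg_zeta_nat n : (2 <= n)%N ->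
  series (fun i => i.+1%:R ^- n : R) @ \oo --> (zeta n%:R : R).
Proof.
move=> n2; rewrite zeta_nat; apply: nondecreasing_is_cvgn.
  by apply: nondecreasing_series => i _ _; rewrite invr_ge0 exprn_ge0.
by exists 2 => _ [N _ <-]; exact: sum_inv_nat_pow_le2.
Qed.

Lemma zeta_nat_ge0_le2 n : (2 <= n)%N -> 0 <= (zeta n%:R : R) <= 2.
Proof.
move=> n2; have zn := cvg_zeta_nat n2; rewrite -(cvg_lim _ zn)//.
apply/andP; split.
  apply: limr_ge; first by apply/cvg_ex; eexists; exact: zn.
  by apply: nearW => N; apply: sumr_ge0 => i _; rewrite invr_ge0 exprn_ge0.
apply: limr_le; first by apply/cvg_ex; eexists; exact: zn.
by apply: nearW => N; apply: sum_inv_nat_pow_le2.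
Qed.

End ZetaNat.

Section EulerRecursion.
Variable R : realType.

(** Up to sign, the elementary symmetric functions of the squared cotangents,
    rescaled by n^(2k) for n = 2N+1; [cot_power_sum] rescales the power sums in
    the same way. *)
Definition cot_coef N k : R :=
  (-1) ^+ k * ('C(N.*2.+1, k.*2.+1)%:R / N.*2.+1%:R ^+ k.*2.+1).

Definition cot_power_sum N k : R :=
  \sum_(j < N) (N.*2.+1%:R * tan (cot_node R N.*2.+1 j)) ^- k.*2.

Lemma cot_newton N k : k.+1%:R * cot_coef N k.+1 =
  - \sum_(i < k.+1) cot_coef N i * cot_power_sum N (k - i).+1.
Proof.
set n := N.*2.+1; have n0 : n%:R != 0 :> R by rewrite pnatr_eq0.
pose Q : {poly R} := \prod_(j < N) (1 - (tan (cot_node R n j) ^- 2) *: 'X).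
have QE i : cot_coef N i = Q`_i / n%:R ^+ i.*2.
  have /(congr1 (fun p : {poly R} => p`_i)) := sin_tan_poly_prod R N.
  rewrite coef_sin_tan_poly coefZ -/Q -/n => E.
  by rewrite /cot_coef -/n mulrA E exprS; field; rewrite n0 expf_neq0.
rewrite QE mulrA newton_identity -/Q mulNr mulr_suml; congr (- _).
apply: eq_bigr => i _; rewrite QE -!mulrA; congr (_ * _).
have -> : k.+1.*2 = (i.*2 + (k - i).+1.*2)%N.
  by rewrite -doubleD addnS subnKC// -ltnS.
rewrite exprD invfM mulrCA; congr (_ * _).
rewrite mulr_suml; apply: eq_bigr => j _.
rewrite -/n; move: (tan _) => t; rewrite exprMn [RHS]invfM [RHS]mulrC; congr (_ * _).
by rewrite -mul2n exprM exprVn.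
Qed.

(** Each of the k factors (n - i) / n of n^_k / n^k tends to 1. *)
Lemma cvg_bin_div_exp k :
  ('C(N.*2.+1, k)%:R / N.*2.+1%:R ^+ k : R) @[N --> \oo] --> (k`!%:R^-1 : R).
Proof.
have H : ((N.*2.+1 ^_ k)%:R / N.*2.+1%:R ^+ k : R) @[N --> \oo] --> (1 : R).
  elim: k => [|k IHk].
    by apply: cvg_near_cst; apply: nearW => N; rewrite ffactn0 expr0 divr1.
  have H : (((N.*2.+1 - k)%:R / N.*2.+1%:R) : R) @[N --> \oo] --> (1 : R).
    apply: (@squeeze_cvgr _ _ _ _ (fun N => 1 - k%:R * harmonic N) (cst 1)).
    - apply: nearW => N /=; have n0 : 0 < N.*2.+1%:R :> R by rewrite ltr0n.
      apply/andP; split; last by rewrite ler_pdivrMr// mul1r ler_nat leq_subr.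
      rewrite ler_pdivlMr// mulrBl mul1r lerBlDl.
      apply: (@le_trans _ _ (k + (N.*2.+1 - k))%:R).
        by rewrite ler_nat -leq_subLR.
      rewrite natrD lerD2r -mulrA ler_peMr// mulrC ler_pdivlMr ?ltr0n// mul1r.
      by rewrite ler_nat ltnS -addnn leq_addr.
    - have H := cvgB (cvg_cst (1 : R)) (cvgMl_tmp (a := k%:R) (@cvg_harmonic R)).
      by rewrite mulr0 subr0 in H; exact: H.
    - exact: cvg_cst.
  rewrite -[X in _ --> X](mulr1 1); apply: cvg_eq_fun (cvg_seqM IHk H) => N /=.
  by rewrite ffactnSr natrM exprSr invfM mulrACA.
rewrite -[X in _ --> X]mul1r.
apply: cvg_eq_fun (cvg_seqM H (cvg_cst (k`!%:R^-1 : R))) => N /=.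
rewrite -bin_ffact natrM.
have f0 : k`!%:R != 0 :> R by rewrite pnatr_eq0 -lt0n fact_gt0.
by rewrite mulrAC mulfK.
Qed.

Lemma cvg_cot_coef k : cot_coef N k @[N --> \oo] --> ((-1) ^+ k / k.*2.+1`!%:R : R).
Proof. by apply: cvgMl_tmp; exact: cvg_bin_div_exp. Qed.

(** The upper bound is sin(t) <= t, because cot(t)^2 + 1 = sin(t)^(-2). *)
Lemma cot_sq_bounds (t : R) : 0 < t < pi / 2 ->
  tan t ^- 2 <= t ^- 2 <= tan t ^- 2 + 1.
Proof.
move=> th; have /andP[l r] := sin_le_id_tan th; have /andP[t0 tpi] := th.
have s0 : 0 < sin t by exact: sin_gt0_pihalf.
have c0 : 0 < cos t by apply: cos_gt0_pihalf; apply/andP; split=> //; lra.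
have := cos2Dsin2 t; rewrite /tan.
move: (sin t) (cos t) l r s0 c0 => s c l r s0 c0 sc.
have -> : (s / c) ^- 2 = c ^+ 2 / s ^+ 2 by field; rewrite !gt_eqF.
have -> : c ^+ 2 / s ^+ 2 + 1 = s ^- 2.
  have s2 : s ^+ 2 != 0 by rewrite expf_neq0// (gt_eqF s0).
  by rewrite -[RHS]mul1r -[in RHS]sc mulrDl (divff s2).
apply/andP; split; last by rewrite lef_pV2 ?posrE ?exprn_gt0// lerXn2r// nnegrE ltW.
rewrite ler_pdivrMr ?exprn_gt0// mulrC ler_pdivlMr ?exprn_gt0// -exprMn.
have tc0 : 0 <= t * c by rewrite mulr_ge0// ltW.
by rewrite mulrC lerXn2r// nnegrE ltW.
Qed.

Lemma subrX_le (a b : R) k : 0 <= b <= a -> a <= 1 ->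
  0 <= a ^+ k - b ^+ k <= k%:R * (a - b).
Proof.
move=> /andP[b0 ba] a1; have a0 := le_trans b0 ba.
rewrite subr_ge0 lerXn2r//= subrXX mulrC ler_wpM2r ?subr_ge0//.
rewrite -[k in k%:R]card_ord -sumr_const ler_sum// => i _.
by rewrite mulr_ile1 ?exprn_ge0// exprn_ile1// (le_trans ba).
Qed.

(** Each of the N terms differs from its limit 1 / ((j+1) pi)^(2k+2) by at most
    (k+1) / n^2 with n = 2N+1, so the total error is of order 1 / N. *)
Lemma cvg_cot_power_sum k :
  cot_power_sum N k.+1 @[N --> \oo] --> (zeta (2 * k.+1)%N%:R / pi ^+ k.+1.*2 : R).
Proof.
have pi0 := pi_gt0 R; have pi2 := pi_ge2 R.
pose S N : R := \sum_(j < N) (j.+1%:R * pi) ^- k.+1.*2.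
have cS : S N @[N --> \oo] --> (zeta (2 * k.+1)%N%:R / pi ^+ k.+1.*2 : R).
  have k2 : (2 <= 2 * k.+1)%N by rewrite mulnS.
  apply: cvg_eq_fun
    (cvg_seqM (cvg_zeta_nat k2) (cvg_cst (pi ^- k.+1.*2 : R))) => N /=.
  rewrite /S /series/= big_mkord mulr_suml; apply: eq_bigr => j _.
  by rewrite mul2n [(_ * pi) ^+ _]exprMn [RHS]invfM.
have SB N : 0 <= S N - cot_power_sum N k.+1 <= k.+1%:R * harmonic N.
  rewrite /S /cot_power_sum -sumrB.
  set n := N.*2.+1; have n0 : 0 < n%:R :> R by rewrite ltr0n.
  have H (j : 'I_N) : 0 <= (j.+1%:R * pi) ^- k.+1.*2
      - (n%:R * tan (cot_node R n j)) ^- k.+1.*2 <= k.+1%:R / n%:R ^+ 2.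
    have nt : j.+1%:R * pi = n%:R * cot_node R n j.
      by rewrite /cot_node [RHS]mulrC divfK// gt_eqF.
    have nj1 : 1 <= n%:R * cot_node R n j.
      by rewrite -nt mulr_ege1 ?ler1n//; lra.
    rewrite nt.
    have /andP[ct tc] := cot_sq_bounds (cot_node_itv R j).
    have th0 : 0 < tan (cot_node R n j) by exact: cot_node_tan_gt0.
    move: (cot_node R n j) (tan _) nj1 ct tc th0 => t u nj1 ct tc u0.
    have t0 : 0 < t by rewrite -(pmulr_rgt0 _ n0) (lt_le_trans ltr01).
    have pow2 x : x ^- k.+1.*2 = (x ^- 2) ^+ k.+1 :> R.
      by rewrite -mul2n exprM exprVn.
    have inv2 (x : R) : (n%:R * x) ^- 2 = n%:R ^- 2 * x ^- 2.
      by rewrite exprMn invfM.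
    rewrite !pow2; have ab : 0 <= (n%:R * u) ^- 2 <= (n%:R * t) ^- 2.
      rewrite invr_ge0 exprn_ge0 ?(ltW (mulr_gt0 n0 u0))//=.
      by rewrite !inv2 ler_pM2l ?invr_gt0 ?exprn_gt0.
    have a1 : (n%:R * t) ^- 2 <= 1.
      by rewrite invf_le1 ?exprn_gt0 ?exprn_ege1// mulr_gt0.
    have /andP[-> /le_trans->//] := subrX_le k.+1 ab a1.
    rewrite ler_wpM2l// !inv2 -mulrBr ler_piMr ?invr_ge0 ?exprn_ge0//.
    by rewrite lerBlDl.
  apply/andP; split; first by apply: sumr_ge0 => j _; have /andP[] := H j.
  apply: (@le_trans _ _ (\sum_(j < N) (k.+1%:R / n%:R ^+ 2))).
    by apply: ler_sum => j _; have /andP[] := H j.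
  rewrite sumr_const card_ord -[_ *+ N]mulr_natr -mulrA ler_wpM2l//.
  rewrite mulrC ler_pdivrMr ?exprn_gt0// mulrC ler_pdivlMr ?ltr0n//.
  rewrite -natrX -natrM ler_nat /n; lia.
have S0 : (fun N => S N - cot_power_sum N k.+1) @ \oo --> (0 : R); last first.
  rewrite -[X in _ --> X]subr0; apply: cvg_eq_fun (cvg_seqB cS S0) => N /=.
  by rewrite subKr.
apply: (@squeeze_cvgr _ _ _ _ (cst 0) (fun N => k.+1%:R * harmonic N)).
- by apply: nearW => N; exact: SB.
- exact: cvg_cst.
- have H := cvgMl_tmp (a := k.+1%:R) (@cvg_harmonic R).
  by rewrite mulr0 in H; exact: H.
Qed.

Definition scaled_zeta k : R := zeta (2 * k)%N%:R / pi ^+ k.*2.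

(** The limit of [cot_newton] as the number of nodes grows. *)
Lemma euler_recursion k :
  k.+1%:R * ((-1) ^+ k.+1 / k.+1.*2.+1`!%:R) =
  - \sum_(i < k.+1) (-1) ^+ i / i.*2.+1`!%:R * scaled_zeta (k - i).+1.
Proof.
have L : (fun N => k.+1%:R * cot_coef N k.+1) @ \oo
    --> k.+1%:R * ((-1) ^+ k.+1 / k.+1.*2.+1`!%:R : R).
  by apply: cvg_seqM; [exact: cvg_cst|exact: cvg_cot_coef].
have Rr : (fun N => - \sum_(i < k.+1) cot_coef N i * cot_power_sum N (k - i).+1)
    @ \oo --> - \sum_(i < k.+1) (-1) ^+ i / i.*2.+1`!%:R * scaled_zeta (k - i).+1.
  apply: cvgN; apply: (@cvg_seq_sum _ _ _ _
    (fun (i : 'I_k.+1) N => cot_coef N i * cot_power_sum N (k - i).+1)) => i _.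
  by apply: cvg_seqM; [exact: cvg_cot_coef|exact: cvg_cot_power_sum].
have /funext E := @cot_newton ^~ k; rewrite E in L.
by rewrite -(cvg_lim _ L)//; exact: cvg_lim.
Qed.

End EulerRecursion.

(** * Cauchy products and uniqueness of power series *)

Section CauchyProduct.
Variable R : realType.
Implicit Types a b : nat -> R.

Lemma series_convolution a b n :
  series (fun n => \sum_(i < n.+1) a i * b (n - i)%N) n
  = \sum_(i < n) a i * series b (n - i)%N.
Proof.
elim: n => [|n IHn]; first by rewrite /series/= big_geq ?big_ord0.
rewrite seriesSr IHn [RHS]big_ord_recr/= subSnn.
rewrite [X in _ + X]big_ord_recr/= subnn addrA -big_split/=; congr (_ + _).
  apply: eq_bigr => i _; rewrite -mulrDr; congr (_ * _).
  by rewrite subSn 1?ltnW// seriesSr.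
by rewrite /series/= big_nat1.
Qed.

(** The partial product minus the partial convolution is a sum over the pairs
    with i, j < n and i + j >= n.  All of them lie outside the square of side
    n./2, so the difference is bounded by U n - U n./2, where U is the
    convergent sequence of products of partial sums of absolute values. *)
Lemma cauchy_product a b (A B : R) :
  series a @ \oo --> A -> series b @ \oo --> B ->
  cvgn (series (fun n => `|a n|)) -> cvgn (series (fun n => `|b n|)) ->
  series (fun n => \sum_(i < n.+1) a i * b (n - i)%N) @ \oo --> A * B.
Proof.
move=> aA bB /cvg_ex[A' /= aA'] /cvg_ex[B' /= bB'].
pose U n := series (fun n => `|a n|) n * series (fun n => `|b n|) n.
have UC : U @ \oo --> A' * B' by exact: cvg_seqM.
have D n : `|series a n * series b n -
    series (fun n => \sum_(i < n.+1) a i * b (n - i)%N) n| <= U n - U n./2.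
  rewrite series_convolution [series a n in X in `|X|]/series/= big_mkord.
  rewrite mulr_suml -sumrB; under eq_bigr do rewrite -mulrBr.
  apply: le_trans (ler_norm_sum _ _ _) _.
  apply: (@le_trans _ _ (\sum_(i < n) `|a i| * (series (fun n => `|b n|) n
      - series (fun n => `|b n|) (n - i)%N))).
    apply: ler_sum => i _; rewrite normrM ler_wpM2l//.
    by rewrite !sub_series_geq ?leq_subr// ler_norm_sum.
  under eq_bigr do rewrite mulrBr; rewrite sumrB -mulr_suml lerB//.
    by rewrite /U [series _ n in X in _ <= X * _]/series/= big_mkord.
  have nd : nondecreasing_seq (series (fun n => `|b n|)).
    by apply: nondecreasing_series.
  have h2 : (n./2 <= n)%N by rewrite -[leqRHS]odd_double_half -addnn addnA leq_addl.
  rewrite -(big_mkord xpredT (fun i => `|a i| * series (fun n => `|b n|) (n - i)%N)).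
  rewrite (big_cat_nat _ h2)//= ler_wpDr//.
    by apply: sumr_ge0 => i _; rewrite mulr_ge0// /series sumr_ge0.
  rewrite /U {1}/series/= mulr_suml !big_mkord; apply: ler_sum => i _.
  rewrite ler_wpM2l//; apply: nd; have := ltn_ord i; lia.
have D0 : (fun n => series a n * series b n -
    series (fun n => \sum_(i < n.+1) a i * b (n - i)%N) n) @ \oo --> (0 : R).
  apply/norm_cvg0P.
  apply: (@squeeze_cvgr _ _ _ _ (cst 0) (fun n => U n - U n./2)).
  - by apply: nearW => n /=; rewrite normr_ge0 D.
  - exact: cvg_cst.
  - rewrite -[X in _ --> X](subrr (A' * B')); apply: cvg_seqB => //.
    apply: cvg_seq_comp UC => N; exists N.*2 => n nN.
    by rewrite -[N]doubleK half_leq.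
rewrite -[X in _ --> X]subr0; apply: cvg_eq_fun (cvg_seqB (cvg_seqM aA bB) D0).
by move=> n /=; rewrite subKr.
Qed.

End CauchyProduct.

Section PowerSeriesUniqueness.
Variable R : realType.

(** If s > 0 is such that the terms d_j s^j are bounded by M, then for q <= 1/2
    the series at q s, which sums to 0, differs from d_0 by at most 2 M q; let q
    tend to 0. *)
Lemma power_series_coef0 (d : nat -> R) :
  (\forall t \near (0 : R)^', series (fun j => d j * t ^+ j) @ \oo --> (0 : R)) ->
  d 0%N = 0.
Proof.
move=> [e /= e0 de]; have {}de t : 0 < t < e ->
    series (fun j => d j * t ^+ j) @ \oo --> (0 : R).
  move=> /andP[t0 te]; apply: de => /=; last by rewrite gt_eqF.
  by rewrite sub0r normrN gtr0_norm.
pose s := e / 2; have /andP[s0 se] : 0 < s < e by rewrite /s; lra.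
have [M [M0 dM]] : exists M, 0 < M /\ forall j, `|d j * s ^+ j| <= M.
  have : cvgn (series (fun j => d j * s ^+ j)).
    by apply/cvg_ex; exists 0; apply: de; rewrite s0.
  move=> /cvg_series_bounded[M [_ dM]].
  exists (Num.max 1 (M + 1)); split; first by rewrite lt_max ltr01.
  by move=> j; apply: (dM _ _ j I); rewrite lt_max ltrDl ltr01 orbT.
have bound q : 0 < q <= 2^-1 -> `|d 0%N| <= 2 * M * q.
  move=> /andP[q0 q2].
  have H : series (fun j => d j * (q * s) ^+ j) @ \oo --> (0 : R).
    by apply: de; rewrite mulr_gt0//=; nra.
  have geo N : \sum_(j < N) q ^+ j <= 2.
    (* the finite geometric sum is (1 - q^N) / (1 - q) with q <= 1/2 *)
    have := subrX1 q N; have : 0 <= q ^+ N by rewrite exprn_ge0// ltW.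
    move: (\sum_(j < N) _) (q ^+ N) => x y; nra.
  have B N : `|series (fun j => d j * (q * s) ^+ j) N.+1 - d 0%N| <= 2 * M * q.
    rewrite /series/= big_nat_recl//= expr0 mulr1 addrAC subrr add0r big_mkord.
    apply: le_trans (ler_norm_sum _ _ _) _.
    apply: (@le_trans _ _ (\sum_(j < N) (M * q) * q ^+ j)).
      apply: ler_sum => j _; have qj : 0 <= q ^+ j.+1 by rewrite exprn_ge0// ltW.
      rewrite exprMn mulrCA normrM (ger0_norm qj) -mulrA -exprS [leRHS]mulrC.
      by rewrite ler_wpM2l.
    rewrite -mulr_sumr -[leRHS]mulrA [leLHS]mulrC ler_wpM2r//.
    by rewrite mulr_ge0 ?ltW.
  have L : (fun N => `|series (fun j => d j * (q * s) ^+ j) N.+1 - d 0%N|) @ \oo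
      --> `|0 - d 0%N|.
    apply: cvg_norm; apply: cvg_seqB; last exact: cvg_cst.
    by rewrite (cvg_shiftS (series (fun j => d j * (q * s) ^+ j))).
  rewrite sub0r normrN in L; rewrite -(cvg_lim _ L)//; apply: limr_le.
    by apply/cvg_ex; eexists; exact: L.
  by apply: nearW => N; exact: B.
apply/eqP; rewrite -normr_le0; apply/ler_addgt0Pl => r r0; rewrite addr0.
pose q := Num.min 2^-1 (r / (2 * M)).
apply: le_trans (bound q _) _.
  by rewrite /q lt_min ge_min lexx invr_gt0 ltr0n andbT divr_gt0 ?mulr_gt0.
by rewrite mulrC -ler_pdivlMr ?mulr_gt0// ge_min lexx orbT.
Qed.

(** Once d_0 = 0, dividing by t shows that the shifted sequence satisfies the
    same hypothesis. *)
Lemma power_series_eq0 (d : nat -> R) :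
  (\forall t \near (0 : R)^', series (fun j => d j * t ^+ j) @ \oo --> (0 : R)) ->
  forall k, d k = 0.
Proof.
move=> d0 k; elim: k d d0 => [|k IHk] d dc; first exact: power_series_coef0.
apply: (IHk (fun j => d j.+1)); near=> t.
have t0 : t != 0 by near: t; exact: nbhs_dnbhs_neq.
have H : (fun n => series (fun j => d j * t ^+ j) n.+1) @ \oo --> (0 : R).
  by rewrite (cvg_shiftS (series _)); near: t; exact: dc.
rewrite -[X in _ --> X](mul0r t^-1).
apply: cvg_eq_fun (cvg_seqM H (cvg_cst (t^-1 : R))) => n /=.
rewrite /series/= big_nat_recl//= (power_series_coef0 dc) mul0r add0r mulr_suml.
by apply: eq_bigr => j _; rewrite exprSr mulrA mulfK.
Unshelve. all: by end_near.
Qed.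

End PowerSeriesUniqueness.

(** * The power series of the hyperbolic cotangent *)

Section CothExpansion.
Variable R : realType.

(** Coefficient of u^(2i) in the expansion of u coth(u). *)
Definition coth_coef i : R :=
  if i is j.+1 then (-1) ^+ j * scaled_zeta R j.+1 *+ 2 else 1.

(** This is the coefficient of u^(2k+1) in (u coth u) sinh u = u cosh u.
    By [euler_recursion] the terms with i > 0 add up to 2k / (2k+1)!, and the
    term i = 0 is 1 / (2k+1)!. *)
Lemma coth_coef_convolution k :
  \sum_(i < k.+1) coth_coef i / ((k - i).*2.+1)`!%:R = (k.*2)`!%:R^-1.
Proof.
case: k => [|k]; first by rewrite big_ord1/= divr1 invr1.
rewrite big_ord_recl/= subn0 mul1r.
have f0 n : n`!%:R != 0 :> R by rewrite pnatr_eq0 -lt0n fact_gt0.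
pose S : R := \sum_(i < k.+1) (-1) ^+ i * scaled_zeta R i.+1 / (k - i).*2.+1`!%:R.
have -> : \sum_(i < k.+1) (-1) ^+ i * scaled_zeta R i.+1 *+ 2
    / (k.+1 - bump 0 i).*2.+1`!%:R = S *+ 2.
  by rewrite -sumrMnl; apply: eq_bigr => i _; rewrite mulrnAl /bump add1n subSS.
have -> : S = k.+1%:R / k.+1.*2.+1`!%:R.
  have := euler_recursion R k; rewrite (reindex_inj rev_ord_inj)/=.
  have -> : \sum_(j < k.+1) (-1) ^+ (k.+1 - j.+1) / ((k.+1 - j.+1).*2.+1)`!%:R
      * scaled_zeta R (k - (k.+1 - j.+1)).+1 = (-1) ^+ k * S.
    rewrite mulr_sumr; apply: eq_bigr => i _.
    have ik : (i <= k)%N by rewrite -ltnS.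
    rewrite subSS subKn// -[(-1) ^+ (k - i)]signr_odd oddB// signr_addb !signr_odd.
    by rewrite -[LHS]mulrA -[LHS]mulrA [X in _ * (_ * X)]mulrC -[in RHS]mulrA.
  rewrite [(-1) ^+ k.+1]exprS mulN1r mulNr mulrN mulrCA => /oppr_inj /(mulfI _)<- //.
  by rewrite signr_eq0.
have -> : k.+1.*2.+1`! = (k.+1.*2.+1 * k.+1.*2`!)%N by rewrite factS.
rewrite natrM -mulr_natl -[k.+1.*2.+1%:R]natr1 -mul2n natrM.
have k0 : 0 < k.+1%:R :> R by rewrite ltr0n.
move: (k.+1%:R) k0 (_`!%:R) (f0 (2 * k.+1)%N) => a a0 f f1.
by field; rewrite f1/= gt_eqF// ltr_wpDl// mulr_ge0// ltW.
Qed.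

(** From zeta <= 2 and pi >= 2; it makes the series converge absolutely for
    |u| <= 1. *)
Lemma coth_coef_le i : `|coth_coef i| <= 4 * 4^-1 ^+ i.
Proof.
case: i => [|j]; first by rewrite /= normr1 expr0; lra.
have j2 : (2 <= 2 * j.+1)%N by rewrite mulnS.
have /andP[z0 z2] := zeta_nat_ge0_le2 R j2.
have pi4 : 4 ^+ j.+1 <= pi ^+ j.+1.*2 :> R.
  rewrite -mul2n exprM lerXn2r ?nnegrE ?exprn_ge0 ?pi_ge0//.
  by rewrite (_ : 4 = 2 ^+ 2) ?lerXn2r ?nnegrE ?pi_ge0 ?pi_ge2// expr2; lra.
rewrite /= normrMn normrM normrX normrN1 expr1n mul1r /scaled_zeta.
have p0 : 0 < pi ^+ j.+1.*2 :> R by rewrite exprn_gt0// pi_gt0.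
rewrite ger0_norm; last by rewrite divr_ge0// ltW.
rewrite exprVn -[_ / _ *+ 2]mulr_natl mulrA ler_pdivrMr// mulrAC.
rewrite ler_pdivlMr ?exprn_gt0//.
apply: ler_pM => //; first by rewrite mulr_ge0.
lra.
Qed.

(** Sums over even indices only; this translates between a series in u^2 and the
    power series in u. *)
Lemma series_double (f : nat -> R) N : (forall i, f i.*2.+1 = 0) ->
  series (fun i => f i.*2) (uphalf N) = series f N.
Proof.
move=> f_odd; elim: N => [|N]; first by rewrite /series/= !big_geq.
rewrite [series f N.+1]seriesSr => <-.
rewrite -(odd_double_half N); case: (odd N); rewrite ?add1n ?add0n.
  by rewrite f_odd addr0; congr series; lia.
have -> : uphalf (N./2.*2).+1 = N./2.+1 by lia.
by rewrite seriesSr uphalf_double.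
Qed.

Lemma cvg_series_double (f : nat -> R) (l : R) : (forall i, f i.*2.+1 = 0) ->
  (series (fun i => f i.*2) @ \oo --> l) <-> (series f @ \oo --> l).
Proof.
move=> f_odd; split=> fl.
  apply: cvg_eq_fun (_ : (series (fun i => f i.*2) \o uphalf) @ \oo --> l) => [N|].
    exact: series_double.
  by apply: cvg_seq_comp fl => N; exists N.*2 => n nN; lia.
apply: cvg_eq_fun (_ : (series f \o double) @ \oo --> l) => [N /=|].
  by rewrite -series_double// uphalf_double.
by apply: cvg_seq_comp fl => N; exists N => n nN /=; lia.
Qed.

Lemma cvg_sinh_series (u : R) :
  series (fun i => u ^+ i.*2.+1 / i.*2.+1`!%:R) @ \oo --> (expR u - expR (- u)) / 2.
Proof.
pose f n : R := (u ^+ n.+1 / n.+1`!%:R - (- u) ^+ n.+1 / n.+1`!%:R) / 2.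
have f_odd i : f i.*2.+1 = 0.
  by rewrite /f exprNn -signr_odd /= odd_double expr0 mul1r subrr mul0r.
have E : (fun i => f i.*2) = (fun i => u ^+ i.*2.+1 / i.*2.+1`!%:R).
  apply/funext => i; rewrite /f exprNn -signr_odd /= odd_double expr1.
  by rewrite mulN1r mulNr opprK; lra.
rewrite -E; apply/(cvg_series_double _ f_odd).
have ce (v : R) : (fun n => series (exp_coeff v) n.+1) @ \oo --> expR v.
  by rewrite (cvg_shiftS (series _)); exact: is_cvg_series_exp_coeff.
apply: cvg_eq_fun
  (cvg_seqM (cvg_seqB (ce u) (ce (- u))) (cvg_cst (2^-1 : R))) => n /=.
rewrite /series /exp_coeff/= !big_nat_recl//= !expr0 opprD addrACA subrr add0r.
rewrite -sumrB mulr_suml.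
by apply: eq_bigr.
Qed.

Lemma cvg_cosh_series (u : R) :
  series (fun i => u ^+ i.*2 / i.*2`!%:R) @ \oo --> (expR u + expR (- u)) / 2.
Proof.
pose f n : R := (u ^+ n / n`!%:R + (- u) ^+ n / n`!%:R) / 2.
have f_odd i : f i.*2.+1 = 0.
  by rewrite /f exprNn -signr_odd /= odd_double expr1 mulN1r mulNr subrr mul0r.
have E : (fun i => f i.*2) = (fun i => u ^+ i.*2 / i.*2`!%:R).
  by apply/funext => i; rewrite /f exprNn -signr_odd odd_double expr0 mul1r; lra.
rewrite -E; apply/(cvg_series_double _ f_odd).
have ce (v : R) : series (exp_coeff v) @ \oo --> expR v.
  exact: is_cvg_series_exp_coeff.
apply: cvg_eq_fun
  (cvg_seqM (cvg_seqD (ce u) (ce (- u))) (cvg_cst (2^-1 : R))) => n /=.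
by rewrite /series /exp_coeff/= -big_split/= mulr_suml; apply: eq_bigr.
Qed.

End CothExpansion.

(** * Bernoulli numbers *)

Section BernoulliNumbers.
Variable R : realType.

Lemma is_cvg_norm_coth_series (u : R) : `|u| <= 1 ->
  cvgn (series (fun i => `|coth_coef R i * u ^+ i.*2|)).
Proof.
move=> u1; apply: (@series_le_cvg _ _ (geometric 4 4^-1)) => //.
- by move=> n; rewrite /geometric/= mulr_ge0// exprn_ge0.
- move=> n; rewrite normrM (le_trans _ (coth_coef_le R n))// ler_piMr//.
  by rewrite normrX exprn_ile1.
- by apply: is_cvg_geometric_series; rewrite ger0_norm//; lra.
Qed.

Lemma is_cvg_norm_sinh_series (u : R) :
  cvgn (series (fun i => `|u ^+ i.*2.+1 / i.*2.+1`!%:R|)).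
Proof.
have -> : (fun i : nat => `|u ^+ i.*2.+1 / i.*2.+1`!%:R|)
    = (fun i => `|u| ^+ i.*2.+1 / i.*2.+1`!%:R).
  by apply/funext => i; rewrite normrM normrX normfV normr_nat.
by apply/cvg_ex; eexists; exact: cvg_sinh_series.
Qed.

(** The Cauchy product with the series of sinh is the series of u cosh. *)
Lemma cvg_coth_series (u : R) : 0 < `|u| <= 1 ->
  series (fun i => coth_coef R i * u ^+ i.*2) @ \oo -->
  u * (expR u + expR (- u)) / (expR u - expR (- u)).
Proof.
move=> /andP[u0 u1].
have cC : cvgn (series (fun i => coth_coef R i * u ^+ i.*2)).
  by apply: normed_cvg; exact: is_cvg_norm_coth_series.
have P := cauchy_product cC (@cvg_sinh_series R u) (is_cvg_norm_coth_series u1)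
  (@is_cvg_norm_sinh_series u).
have Q : series (fun n => \sum_(i < n.+1) coth_coef R i * u ^+ i.*2
    * (u ^+ (n - i).*2.+1 / (n - i).*2.+1`!%:R)) @ \oo
    --> u * ((expR u + expR (- u)) / 2).
  apply: cvg_eq_fun (cvg_seqM (cvg_cst (u : R)) (@cvg_cosh_series R u)) => N /=.
  rewrite /series/= mulr_sumr; apply: eq_bigr => n _.
  rewrite -coth_coef_convolution mulr_sumr mulr_sumr; apply: eq_bigr => i _.
  have -> : u ^+ n.*2 = u ^+ i.*2 * u ^+ (n - i).*2.
    by rewrite -exprD -doubleD subnKC// -ltnS.
  by rewrite exprS; ring.
have E := cvg_unique (@norm_hausdorff _ R) P Q.
suff -> : u * (expR u + expR (- u)) / (expR u - expR (- u))
  = limn (series (fun i => coth_coef R i * u ^+ i.*2)) by [].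
have sh0 : expR u - expR (- u) != 0.
  rewrite subr_eq0; apply/eqP => /expR_inj; move: u0; rewrite normr_gt0 => /eqP.
  by lra.
apply: (mulIf sh0); rewrite divfK//; move: E.
move: (limn _) (expR u + _) (expR u - _) => a b c E.
have -> : a * c = a * (c / 2) * 2 by field.
by rewrite E; field.
Qed.

(** The coefficients read off from t / (e^t - 1) = (t/2) coth (t/2) - t/2. *)
Definition bernoulli_coth j : R :=
  j`!%:R * ((if odd j then 0 else coth_coef R j./2 / 2 ^+ j) - (j == 1)%:R / 2).

Lemma bernoulli_egf_coth : bernoulli_egf bernoulli_coth.
Proof.
rewrite /bernoulli_egf; near=> t.
have t0 : t != 0 by near: t; exact: nbhs_dnbhs_neq.
have t1 : `|t| < 1 by near: t; exact: dnbhs0_lt.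
pose u := t / 2.
have u0 : u != 0 by rewrite /u mulf_neq0.
have u1 : `|u| <= 1 by rewrite /u normrM normfV normr_nat; lra.
have C : series (fun i => coth_coef R i * u ^+ i.*2) @ \oo -->
    u * (expR u + expR (- u)) / (expR u - expR (- u)).
  by apply: cvg_coth_series; rewrite normr_gt0 u0.
pose f j := if odd j then 0 else coth_coef R j./2 * u ^+ j.
have f_odd i : f i.*2.+1 = 0 by rewrite /f /= odd_double.
have fE : (fun i => coth_coef R i * u ^+ i.*2) = (fun i => f i.*2).
  by apply/funext => i; rewrite /f odd_double doubleK.
rewrite fE in C; have {}C := (cvg_series_double _ f_odd).1 C.
have L : series (fun j => (j == 1)%:R * u) @ \oo --> u.
  apply: (@cvg_near_cst); exists 2%N => // n /= n2.
  rewrite /series/= -(subnKC n2) big_nat_recl// big_nat_recl//= mul0r mul1r.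
  by rewrite big1 ?addr0 ?add0r// => i _; rewrite mul0r.
have -> : t / (expR t - 1) = u * (expR u + expR (- u)) / (expR u - expR (- u)) - u.
  have -> : t = u + u by rewrite /u; lra.
  rewrite expRD expRN.
  have E0 : expR u != 0 by rewrite gt_eqF// expR_gt0.
  have E1 : expR u * expR u - 1 != 0.
    rewrite -expRD subr_eq0 -expR0; apply/eqP => /expR_inj; move: u0 => /eqP; lra.
  by field; rewrite E0 E1.
apply: cvg_eq_fun (cvg_seqB C L) => n /=.
rewrite /series/= -sumrB; apply: eq_bigr => j _.
have j0 : j`!%:R != 0 :> R by rewrite pnatr_eq0 -lt0n fact_gt0.
rewrite /bernoulli_coth [RHS]mulrAC [_`!%:R * _]mulrC mulfK// mulrBl.
congr (_ - _).
  rewrite /f; case: ifP => _; first by rewrite mul0r.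
  by rewrite /u expr_div_n mulrA mulrAC.
by case: eqP => [->|_]; rewrite ?mul0r// expr1 !mul1r mulrC.
Unshelve. all: by end_near.
Qed.

(** Two solutions of the defining equation differ by a power series that
    vanishes near 0. *)
Lemma bernoulli_numberE j : bernoulli_number R j = bernoulli_coth j.
Proof.
have H : bernoulli_egf (bernoulli_number R).
  exact: (xgetPex _ (ex_intro _ _ bernoulli_egf_coth)).
have j0 : j`!%:R != 0 :> R by rewrite pnatr_eq0 -lt0n fact_gt0.
apply/(divIf j0)/eqP; rewrite -subr_eq0 -mulrBl; apply/eqP.
apply: (power_series_eq0
  (d := fun j => (bernoulli_number R j - bernoulli_coth j) / j`!%:R)).
near=> t.
have A : series (fun j => bernoulli_number R j * t ^+ j / j`!%:R) @ \oo
  --> t / (expR t - 1) by near: t; exact: H.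
have B : series (fun j => bernoulli_coth j * t ^+ j / j`!%:R) @ \oo
  --> t / (expR t - 1) by near: t; exact: bernoulli_egf_coth.
rewrite -[X in _ --> X](subrr (t / (expR t - 1))).
apply: cvg_eq_fun (cvg_seqB A B) => n /=.
by rewrite /series/= -sumrB; apply: eq_bigr => i _; rewrite -mulrBl -mulrBl mulrAC.
Unshelve. all: by end_near.
Qed.

Lemma euler_zeta_even k : (0 < k)%N ->
  bernoulli_number R (2 * k) / (2 * k)`!%:R =
  (-1) ^+ k.-1 * zeta (2 * k)%N%:R *+ 2 / (2 * pi) ^+ (2 * k).
Proof.
case: k => // k _; rewrite bernoulli_numberE /bernoulli_coth mulrAC.
have j0 : (2 * k.+1)`!%:R != 0 :> R by rewrite pnatr_eq0 -lt0n fact_gt0.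
have od : odd (2 * k.+1) = false by rewrite mul2n odd_double.
have hf : (2 * k.+1)./2 = k.+1 by rewrite mul2n doubleK.
have n1 : (2 * k.+1 == 1)%N = false by lia.
rewrite divff// mul1r od hf n1.
rewrite mul0r subr0 /coth_coef /scaled_zeta -[k.+1.*2]mul2n.
rewrite [(2 * pi) ^+ _]exprMn /=.
have a0 : 2 ^+ (2 * k.+1) != 0 :> R by rewrite expf_neq0// pnatr_eq0.
have b0 : pi ^+ (2 * k.+1) != 0 :> R by rewrite expf_neq0// gt_eqF// pi_gt0.
move: (2 ^+ _) (pi ^+ _) (zeta _) (_ ^+ k) a0 b0 => a b z e a0 b0.
by field; rewrite a0 b0.
Qed.

End BernoulliNumbers.

(** * Multiple zeta sums over partitions *)

Lemma cvg_partition_sum (R : realType) m (c : nat -> nat -> R) (d : nat -> R) :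
  (forall i, (i < m)%N -> (fun N => c N i) @ \oo --> d i) ->
  (fun N => partition_sum m (c N)) @ \oo --> partition_sum m d.
Proof.
move=> cd; apply: (@cvg_seq_sum _ _ _ _ (fun (y : {ffun 'I_m -> 'I_m.+1}) N =>
  \prod_(i < m) (c N i ^+ y i / (y i)`!%:R))) => y _.
apply: (@cvg_seq_prod _ _ _ _ (fun (i : 'I_m) N => c N i ^+ y i / (y i)`!%:R)) => i _.
apply: cvg_seqM; last exact: cvg_cst.
rewrite (_ : (fun N => _) = (fun N => \prod_(j < y i) c N i)); last first.
  by apply/funext => N; rewrite prodr_const card_ord.
rewrite -[X in _ ^+ X]card_ord -prodr_const.
by apply: (@cvg_seq_prod _ _ _ _ (fun _ N => c N i)) => j _; exact: cd.
Qed.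

Lemma esum_multiple_zeta (R : realType) m q : (2 <= q)%N ->
  (\esum_(N in increasing_tuples m)
     (\prod_(i < m) ((tnth N i)%:R ^- q : R))%R%:E =
   ((-1) ^+ m * partition_sum m (fun j => - zeta (j.+1 * q)%N%:R / j.+1%:R))%:E)%E.
Proof.
move=> q2; apply: (@esum_increasing_tuples R (fun k => k%:R ^- q)).
  by move=> k; rewrite invr_ge0 exprn_ge0.
have H : (fun M => (-1) ^+ m * partition_sum m (fun j =>
    - (\sum_(i < M) (i.+1%:R ^- q) ^+ j.+1) / j.+1%:R) : R) @ \oo -->
    (-1) ^+ m * partition_sum m (fun j => - zeta (j.+1 * q)%N%:R / j.+1%:R).
  apply: cvg_seqM; first exact: cvg_cst.
  apply: cvg_partition_sum => j _; apply: cvg_seqM; last exact: cvg_cst.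
  apply: cvgN; have jq : (2 <= j.+1 * q)%N by rewrite (leq_trans q2)// leq_pmull.
  apply: cvg_eq_fun (cvg_zeta_nat jq) => M.
  rewrite /series/= big_mkord; apply: eq_bigr => i _.
  by rewrite mulnC exprM exprVn.
apply: cvg_eq_fun H => M.
rewrite -partition_sum_power_sums coef_prod_1subX mulrA -exprD addnn -signr_odd.
by rewrite odd_double mul1r.
Qed.

Lemma partition_factorE (F : fieldType) (z c : F) k :
  (-1) ^+ k / (k`!%:R * c ^+ k) * z ^+ k = (- z / c) ^+ k / k`!%:R.
Proof. by rewrite expr_div_n [(- z) ^+ k]exprNn invfM; ring. Qed.

Theorem theorem5p2 (R : realType) (m p : nat) (hp : (1 <= p)%N) :
  let zeta_sum : R :=
    (-1) ^+ m *
    \sum_(y : {ffun 'I_m -> 'I_m.+1} | is_partition y)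
      \prod_(i < m)
        ((-1) ^+ y i / ((y i)`!%:R * i.+1%:R ^+ y i)
         * zeta (2 * i.+1 * p)%N%:R ^+ y i) in
  let bernoulli_sum : R :=
    (-1) ^+ (p.+1 * m) * (2 * pi) ^+ (2 * p * m) *
    \sum_(y : {ffun 'I_m -> 'I_m.+1} | is_partition y)
      \prod_(i < m)
        (1 / (y i)`!%:R
         * (bernoulli_number R (2 * i.+1 * p)
            / ((2 * i.+1)%N%:R * (2 * i.+1 * p)`!%:R)) ^+ y i) in
  (\esum_(N in increasing_tuples m)
     (1 / \prod_(i < m) (tnth N i)%:R ^+ (2 * p) : R)%R%:E = zeta_sum%:E)%E
  /\ zeta_sum = bernoulli_sum.
Proof.
move=> zeta_sum bernoulli_sum; split.
  rewrite (eq_esum (b := fun N : m.-tuple nat =>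
    (\prod_(i < m) (tnth N i)%:R ^- (2 * p) : R)%R%:E)%E); last first.
    by move=> N _; rewrite div1r -prodfV.
  have p2 : (2 <= 2 * p)%N by rewrite leq_pmulr.
  rewrite esum_multiple_zeta//; congr (_%:E); congr (_ * _).
  apply: eq_bigr => y _; apply: eq_bigr => i _.
  have -> : (i.+1 * (2 * p) = 2 * i.+1 * p)%N by lia.
  by rewrite partition_factorE.
rewrite /zeta_sum /bernoulli_sum.
rewrite mulSn exprD -!mulrA; congr (_ * _); rewrite !mulr_sumr.
apply: eq_bigr => y /eqP ym.
(* the partition y shares out the powers of -1 and 2 pi among the parts: the part i+1
   receives the exponents (i+1) p y_i and 2 (i+1) p y_i *)
have pm : (p * m = \sum_(i < m) i.+1 * p * y i)%N.
  by rewrite -{1}ym big_distrr; apply: eq_bigr => i _ /=; lia.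
rewrite -mulnA pm exprM [X in X * _]expr_sum [X in _ * (X * _)]expr_sum -!big_split/=.
apply: eq_bigr => i _; set k := (i.+1 * p)%N.
have k0 : (0 < k)%N by rewrite muln_gt0.
have -> : (2 * i.+1 * p = 2 * k)%N by rewrite mulnA.
pose b := bernoulli_number R (2 * k) / ((2 * i.+1)%N%:R * (2 * k)`!%:R).
have bE : (-1) ^+ k * (2 * pi) ^+ (2 * k) * b = - zeta (2 * k)%N%:R / i.+1%:R.
  have f0 : (2 * k)`!%:R != 0 :> R by rewrite pnatr_eq0 -lt0n fact_gt0.
  have i0 : i.+1%:R != 0 :> R by rewrite pnatr_eq0.
  have p0 : (2 * pi) ^+ (2 * k) != 0 :> R.
    by rewrite expf_neq0// mulf_neq0// gt_eqF// pi_gt0.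
  have /(congr1 (fun x => x * (2 * k)`!%:R)) := euler_zeta_even R k0.
  rewrite divfK// /b => ->; rewrite -[in (-1) ^+ k](prednK k0) exprS.
  rewrite [(2 * i.+1)%:R]natrM; have := sqrr_sign R k.-1; rewrite -signr_odd.
  move: (_ ^+ odd _) (zeta _) (_`!%:R) (_ ^+ (2 * k)) (i.+1%:R) f0 i0 p0.
  move=> e z f q c f0 c0 q0 e1.
  transitivity (- (e ^+ 2) * z / c); last by rewrite e1 mulN1r.
  by field; rewrite f0 c0 q0.
rewrite -/b.
have -> : (2 * pi) ^+ 2 ^+ (k * y i) = (2 * pi) ^+ (2 * k) ^+ y i :> R.
  by rewrite -!exprM mulnA.
rewrite [(-1) ^+ (k * _)]exprM partition_factorE -bE !exprMn; ring.
Qed.
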